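(* Assume $K=|\mathcal D|\ge 3$. Let $\ell^{\mathrm{add}}(d;\boldsymbol y,\boldsymbol x)=\varpi(\boldsymbol y,\boldsymbol x)+\sum_{k\in\mathcal D}\omega_k(d,y_k,\boldsymbol x)$ be an additive counterfactual loss, with $\omega_k:\mathcal D\times\mathcal Y\times\mathcal X\to\mathbb R$ and $\varpi:\mathcal Y^{\mathcal D}\times\mathcal X\to\mathbb R$ bounded measurable. Then there exists no standard loss $\ell^{\mathrm{std}}(d;y_d,\boldsymbol x)$ such that for every $P\in\mathcal P$ the risk difference $R_P(\pi;\ell^{\mathrm{add}})-R_P(\pi;\ell^{\mathrm{std}})$ is independent of the policy $\pi:\mathcal X\to\Delta(\mathcal D)$, if and only if at least one weight function $\omega_k$ is not off-diagonal additively separable, i.e. for at least one $k\in\mathcal D$ there do not exist bounded measurable functions $f_k:(\mathcal D\setminus\{k\})\times\mathcal X\to\mathbb R$ and $g_k:\mathcal Y\times\mathcal X\to\mathbb R$ such that $$\omega_k(d,y,\boldsymbol x)=f_k(d,\boldsymbol x)+g_k(y,\boldsymbol x)\quad\text{for all } d\in\mathcal D\setminus\{k\},\ y\in\mathcal Y,\ \boldsymbol x\in\mathcal X.$$ If all the weight functions are off-diagonal additively separable, i.e. for every $k\in\mathcal D$ there exist bounded measurable functions $f_k:(\mathcal D\setminus\{k\})\times\mathcal X\to\mathbb R$ and $g_k:\mathcal Y\times\mathcal X\to\mathbb R$ such that $\omega_k(d,y,\boldsymbol x)=f_k(d,\boldsymbol x)+g_k(y,\boldsymbol x)$ for all $d\in\mathcal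 D\setminus\{k\}$, $y\in\mathcal Y$, $\boldsymbol x\in\mathcal X$, then a standard loss $\ell^{\mathrm{std}}$ with the property that for every $P\in\mathcal P$ the risk difference $R_P(\pi;\ell^{\mathrm{add}})-R_P(\pi;\ell^{\mathrm{std}})$ is independent of the policy $\pi:\mathcal X\to\Delta(\mathcal D)$ exists and is given by $$\ell^{\mathrm{std}}(d;y_d,\boldsymbol x)=\omega_d(d,y_d,\boldsymbol x)-g_d(y_d,\boldsymbol x)+\sum_{k\in\mathcal D,\,k\ne d}f_k(d,\boldsymbol x),$$ and this standard loss is unique (among standard losses with that property) up to the addition of a bounded measurable function of the covariates.
   Context: Setup. Let $\mathcal X$ be an arbitrary measurable space, $K,M\ge 2$ integers, $\mathcal D=\{0,\dots,K-1\}$ (decisions), $\mathcal Y=\{0,\dots,M-1\}$ (outcomes). $\Delta(S)$ denotes the set of probability measures on $S$. Potential outcomes are $Y(k)\in\mathcal Y$, $k\in\mathcal D$, with $Y(\mathcal D)=(Y(0),\dots,Y(K-1))\in\mathcal Y^{\mathcal D}$; covariates are $\boldsymbol X\in\mathcal X$; $D\in\mathcal D$ is the observed decision. Given a law $P_{Y(\mathcal D),\boldsymbol X}\in\Delta(\mathcal Y^{\mathcal D}\times\mathcal X)$ and a treatment assignment mechanism (a measurable map $e:\mathcal Y^{\mathcal D}\times\mathcal X\to\Delta(\mathcal D)$), the joint law $P=e\cdot P_{Y(\mathcal D),\boldsymbol X}$ of $(D,Y(\mathcal D),\boldsymbol X)$ is $$P(D=k,Y(\mathcal D)=\boldsymbol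 y,\boldsymbol X\in A)=\int_A e(k;\boldsymbol y,\boldsymbol x)\,P_{Y(\mathcal D)\mid\boldsymbol X}(Y(\mathcal D)=\boldsymbol y\mid\boldsymbol X=\boldsymbol x)\,dP_{\boldsymbol X}(\boldsymbol x)$$ for $A\subseteq\mathcal X$ measurable. Strong ignorability of $e$ with respect to $P_{Y(\mathcal D),\boldsymbol X}$: (a) unconfoundedness, $e(d;\boldsymbol y,\boldsymbol x)=e(d;\boldsymbol x)$ for every $d\in\mathcal D$, $P_{Y(\mathcal D),\boldsymbol X}$-a.s.; (b) overlap, $e(d;\boldsymbol x)>0$ for every $d\in\mathcal D$, $P_{\boldsymbol X}$-a.s. $\mathcal P$ is the set of all joint laws $P=e\cdot P_{Y(\mathcal D),\boldsymbol X}$ with $P_{Y(\mathcal D),\boldsymbol X}\in\Delta(\mathcal Y^{\mathcal D}\times\mathcal X)$ arbitrary and $e$ strongly ignorable with respect to it. A policy is a (measurable) map $\pi:\mathcal X\to\Delta(\mathcal D)$, written $\pi(d;\boldsymbol x)$. A counterfactual loss is a measurable function $\ell:\mathcal D\times\mathcal Y^{\mathcal D}\times\mathcal X\to\mathbb R$; all losses are assumed bounded. A standard loss is a (bounded) counterfactual loss depending on $\boldsymbol y$ only through $y_d$, written $\ell^{\mathrm{std}}(d;y_d,\boldsymbol x)$. The counterfactual risk is $$R_P(\pi;\ell)=\mathbb E_{P_{\boldsymbol X}}\Big[\sum_{d\in\mathcal D}\sum_{\boldsymbol y\in\mathcal Y^{\mathcal D}}\ell(d;\boldsymbol y,\boldsymbol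 X)\,\pi(d;\boldsymbol X)\,P(Y(\mathcal D)=\boldsymbol y\mid\boldsymbol X)\Big].$$ *)

(* Defs.v *)
From HB Require Import structures.
From mathcomp Require Export all_boot all_order all_algebra.
From mathcomp Require Export all_classical all_reals all_analysis.

Set Implicit Arguments.
Unset Strict Implicit.
Unset Printing Implicit Defensive.

Import Order.TTheory GRing.Theory Num.Theory.
Import numFieldNormedType.Exports.

Local Open Scope classical_set_scope.
Local Open Scope charge_scope.
Local Open Scope ring_scope.

(* The finite decision and outcome spaces carry the discrete sigma-algebra.
   Measurable types are pointed, hence the successors: throughout, the numbers
   of decisions and of outcomes are K = K'.+1 and M = M'.+1. *)
HB.instance Definition _ (n : nat) := isPointed.Build 'I_n.+1 ord0.
HB.instance Definition _ (n : nat) :=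
  @isMeasurable.Build default_measure_display 'I_n.+1 discrete_measurable
    discrete_measurable0 discrete_measurableC discrete_measurableU.

HB.instance Definition _ (m n : nat) :=
  isPointed.Build {ffun 'I_m.+1 -> 'I_n.+1} [ffun=> ord0].
HB.instance Definition _ (m n : nat) :=
  @isMeasurable.Build default_measure_display {ffun 'I_m.+1 -> 'I_n.+1}
    discrete_measurable discrete_measurable0 discrete_measurableC
    discrete_measurableU.

HB.instance Definition _ d1 d2 (T1 : measurableType d1)
    (T2 : measurableType d2) :=
  isMeasurableFun.Build _ _ _ _ (@snd T1 T2) measurable_snd.

Definition bounded_measurable d (T : measurableType d) (R : realType)
    (A : set T) (f : T -> R) : Prop :=
  measurable_fun A f /\ [bounded f x | x in A].

Notation decision K' := 'I_K'.+1 (only parsing).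
Notation outcome M' := 'I_M'.+1 (only parsing).
Notation potential K' M' := {ffun 'I_K'.+1 -> 'I_M'.+1}.

Section conditional_probability.
Context (R : realType) (K' M' : nat) dX (X : measurableType dX).
Variable Q : probability (potential K' M' * X)%type R.

Definition covariate_law : probability X R := distribution Q snd.

Section joint_at.
Variable y : potential K' M'.

Definition joint_at (A : set X) : \bar R := Q ([set y] `*` A).

Let joint_at0 : joint_at set0 = 0%E.
Proof. by rewrite /joint_at setX0 measure0. Qed.

Let joint_at_fin A : measurable A -> joint_at A \is a fin_num.
Proof. by move=> mA; apply: fin_num_measure; exact: measurableX. Qed.

Let joint_at_sigma_additive : semi_sigma_additive joint_at.
Proof.
move=> F mF tF mUF; rewrite /joint_at setX_bigcupr.
apply: measure_semi_sigma_additive.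
- by move=> i; exact: measurableX.
- apply/trivIsetP => i j _ _ ij; move/trivIsetP : tF => /(_ i j I I ij) FF0.
  by rewrite -setXI setIid FF0 setX0.
- by rewrite -setX_bigcupr; exact: measurableX.
Qed.

HB.instance Definition _ := isCharge.Build _ _ _ joint_at
  joint_at0 joint_at_fin joint_at_sigma_additive.

End joint_at.

(* A version of x |-> Q(Y = y | X = x). *)
Definition cond_prob (y : potential K' M') : X -> R :=
  fun x => fine (('d (joint_at y) '/d covariate_law) x).

End conditional_probability.

Section counterfactual_risk.
Context (R : realType) (K' M' : nat) dX (X : measurableType dX).

Local Notation D := (decision K').
Local Notation Y := (outcome M').
Local Notation YD := (potential K' M').

(* Maps into the probability measures on D are probability kernels. *)
Definition mechanism := R.-pker (YD * X) ~> D.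
Definition policy := R.-pker X ~> D.

(* e0 x is e(.; x) in "e(d; y, x) = e(d; x) almost surely". *)
Definition strongly_ignorable (e : mechanism)
    (Q : probability (YD * X)%type R) : Prop :=
  exists e0 : R.-pker X ~> D,
    {ae Q, forall p, forall d : D, e p [set d] = e0 p.2 [set d]} /\
    {ae covariate_law Q, forall x, forall d : D, (0 < e0 x [set d])%E}.

Definition is_joint_law (P : probability (D * (YD * X))%type R)
    (e : mechanism) (Q : probability (YD * X)%type R) : Prop :=
  forall (k : D) (y : YD) (A : set X), measurable A ->
    P ([set k] `*` ([set y] `*` A)) =
    (\int[covariate_law Q]_(x in A)
       (e (y, x) [set k] * (cond_prob Q y x)%:E))%E.

Definition ignorable_laws : set (probability (D * (YD * X))%type R) :=
  [set P | exists (e : mechanism) (Q : probability (YD * X)%type R),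
     strongly_ignorable e Q /\ is_joint_law P e Q].

Definition potential_law (P : probability (D * (YD * X))%type R) :
  probability (YD * X)%type R := distribution P snd.

Definition is_loss (l : D -> YD -> X -> R) : Prop :=
  bounded_measurable [set: D * YD * X] (fun p => l p.1.1 p.1.2 p.2).

Definition std_loss (s : D -> Y -> X -> R) : D -> YD -> X -> R :=
  fun d y x => s d (y d) x.

Definition is_std_loss (s : D -> Y -> X -> R) : Prop := is_loss (std_loss s).

Definition add_loss (w0 : YD -> X -> R) (w : D -> D -> Y -> X -> R) :
    D -> YD -> X -> R :=
  fun d y x => w0 y x + \sum_k w k d (y k) x.

Definition risk (P : probability (D * (YD * X))%type R) (pi : policy)
    (l : D -> YD -> X -> R) : R :=
  fine 'E_(covariate_law (potential_law P))
    [fun x => \sum_(d : D) \sum_(y : YD)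
       l d y x * fine (pi x [set d]) * cond_prob (potential_law P) y x].

Definition policy_free_gap (l l' : D -> YD -> X -> R) : Prop :=
  forall P, ignorable_laws P -> forall pi pi' : policy,
    risk P pi l - risk P pi l' = risk P pi' l - risk P pi' l'.

(* f is a function of (D \ {k}) x X: its values at d = k are irrelevant. *)
Definition offdiag_decomp (k : D) (wk : D -> Y -> X -> R)
    (f : D -> X -> R) (g : Y -> X -> R) : Prop :=
  [/\ bounded_measurable ([set d : D | d != k] `*` [set: X])
        (fun p => f p.1 p.2),
      bounded_measurable [set: Y * X] (fun p => g p.1 p.2) &
      forall (d : D) (y : Y) (x : X), d != k -> wk d y x = f d x + g y x].

Definition offdiag_separable (k : D) (wk : D -> Y -> X -> R) : Prop :=
  exists f g, offdiag_decomp k wk f g.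

Definition induced_std_loss (w : D -> D -> Y -> X -> R)
    (f : D -> D -> X -> R) (g : D -> Y -> X -> R) : D -> Y -> X -> R :=
  fun d y x => w d d y x - g d y x + \sum_(k | k != d) f k d x.

End counterfactual_risk.

(* Main.v *)
Require Import Defs.
From mathcomp Require Import measurable_realfun ring lra.

Set Implicit Arguments.
Unset Strict Implicit.
Unset Printing Implicit Defensive.

Import Order.TTheory GRing.Theory Num.Theory.
Import numFieldNormedType.Exports.

Local Open Scope classical_set_scope.
Local Open Scope charge_scope.
Local Open Scope ring_scope.

(** The additive loss and a standard loss have a policy-independent risk
    difference exactly when, pointwise in the potential outcomes [y] and the
    covariates [x], the residual
    [\sum_k w k d (y k) x - s d (y d) x] does not depend on the decision [d]
    ([policy_free_std_lossP]).

    If the residual is some [c y x], then, as the probabilities [pi x [set d]]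
    sum to one, the difference of conditional risks is the [c]-average of the
    conditional law of the potential outcomes, in which [pi] no longer occurs;
    boundedness of the losses provides the integrability needed to subtract
    the risks.  Conversely, the set of ignorable laws contains every law of
    potential outcomes and covariates, combined with a decision drawn uniformly
    and independently ([ignorable_randomised]).  Take a point mass at [(y, x)]
    and the policy that always chooses [d]: the difference of risks is then the
    difference of the losses at [(d, y, x)].  Every conditional probability
    at stake is evaluated at the atom [x] only, where a version is forced, so
    an identity for all [x] results, not merely almost everywhere.

    The rest is algebra of residuals.
    - When [w k d a x = f k d x + g k a x] off the diagonal, the induced
      standard loss removes every term that depends on [d] and leaves
      [\sum_k g k (y k) x] ([residual_induced]).
    - When the residual is free of the decision, compare two decisions
      [d, d0 != k] and let only the outcome [y k] vary: the standard loss does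
      not see the change, so [w k d a x - w k d0 a x] is independent of [a], and
      this is separability ([offdiag_separable_of_residual]).
    - The difference of two suitable standard losses takes the same value at
      [(d, y d)] for all decisions [d]; with two decisions the arguments
      [y d] and [y d'] can be chosen freely, so it depends on [x] alone
      ([std_loss_difference_const]). *)

(** * Bounded measurable functions *)

Section bounded_measurable_theory.
Context (R : realType).

Lemma bounded_measurableP d (T : measurableType d) (A : set T) (f : T -> R) :
  bounded_measurable A f <->
  measurable_fun A f /\ exists C : R, forall x, A x -> `|f x| <= C.
Proof.
split=> -[mf].
- case=> C [_ hC]; split=> //; exists (C + 1) => x Ax.
  by apply: (hC (C + 1)) => //; rewrite ltrDl.
- case=> C hC; split=> //; exists C; split; first exact: num_real.
  by move=> B CB x Ax; exact: le_trans (hC x Ax) (ltW CB).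
Qed.

(** The set [A] allows for composing a function that is controlled on [A] only,
    such as an off-diagonal component, with a map into [A]. *)
Lemma bounded_measurable_comp d d' (T : measurableType d)
    (U : measurableType d') (A : set U) (f : U -> R) (phi : T -> U) :
  measurable A -> measurable_fun setT phi -> (forall x, A (phi x)) ->
  bounded_measurable A f -> bounded_measurable setT (f \o phi).
Proof.
move=> mA mphi phiA /bounded_measurableP[mf [C hC]].
apply/bounded_measurableP; split; last by exists C => x _; exact: hC.
by apply: (measurable_comp mA) => //; move=> _ [x _ <-]; exact: phiA.
Qed.

Lemma bounded_measurable_sub d (T : measurableType d) (A B : set T)
    (f : T -> R) : measurable A -> B `<=` A ->
  bounded_measurable A f -> bounded_measurable B f.
Proof.
move=> mA BA /bounded_measurableP[mf [C hC]].
apply/bounded_measurableP; split; first exact: measurable_funS mf.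
by exists C => x /BA; exact: hC.
Qed.

Lemma bounded_measurable0 d (T : measurableType d) :
  bounded_measurable [set: T] (fun=> 0 : R).
Proof.
by apply/bounded_measurableP; split=> //; exists 0 => x _; rewrite normr0.
Qed.

Lemma bounded_measurableD d (T : measurableType d) (f g : T -> R) :
  bounded_measurable setT f -> bounded_measurable setT g ->
  bounded_measurable setT (fun x => f x + g x).
Proof.
move=> /bounded_measurableP[mf [B hB]] /bounded_measurableP[mg [C hC]].
apply/bounded_measurableP; split; first exact: measurable_funD.
exists (B + C) => x _; rewrite (le_trans (ler_normD _ _))// lerD//.
  exact: hB.
exact: hC.
Qed.

Lemma bounded_measurableB d (T : measurableType d) (f g : T -> R) :
  bounded_measurable setT f -> bounded_measurable setT g ->
  bounded_measurable setT (fun x => f x - g x).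
Proof.
move=> bf /bounded_measurableP[mg [C hC]]; apply: bounded_measurableD => //.
apply/bounded_measurableP; split; first exact: measurable_funN.
by exists C => x _; rewrite normrN; exact: hC.
Qed.

Lemma bounded_measurableM d (T : measurableType d) (f g : T -> R) :
  bounded_measurable setT f -> bounded_measurable setT g ->
  bounded_measurable setT (fun x => f x * g x).
Proof.
move=> /bounded_measurableP[mf [B hB]] /bounded_measurableP[mg [C hC]].
apply/bounded_measurableP; split; first exact: measurable_funM.
by exists (B * C) => x _; rewrite normrM ler_pM// ?hB ?hC.
Qed.

Lemma bounded_measurable_sum d (T : measurableType d) (I : Type) (s : seq I)
    (P : pred I) (f : I -> T -> R) :
  (forall i, P i -> bounded_measurable setT (f i)) ->
  bounded_measurable setT (fun x => \sum_(i <- s | P i) f i x).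
Proof.
move=> bf; have -> : (fun x => \sum_(i <- s | P i) f i x) =
    \sum_(i <- s | P i) f i by apply/funext => x; rewrite fct_sumE.
elim/big_ind: _ => //; first exact: bounded_measurable0.
by move=> g h; exact: bounded_measurableD.
Qed.

(** On a finite discrete factor there is nothing to check but the sections: a
    preimage is a finite union of rectangles, and a finite maximum of bounds is
    a bound. *)
Lemma bounded_measurable_finite_prod d d' (T : measurableType d)
    (X : measurableType d') (f : T -> X -> R) :
  finite_set [set: T] -> (forall t : T, measurable [set t]) ->
  (forall t, bounded_measurable [set: X] (f t)) ->
  bounded_measurable [set: T * X] (fun p => f p.1 p.2).
Proof.
move=> finT mT bf; apply/bounded_measurableP; split.
  move=> _ B mB; rewrite setTI.
  have -> : (fun p : T * X => f p.1 p.2) @^-1` B =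
      \bigcup_(t in [set: T]) ([set t] `*` (f t @^-1` B)).
    apply/seteqP; split=> [[t x] /= Bx|[t x] [t' _ [/= -> //]]].
    by exists t.
  apply: fin_bigcup_measurable => // t _; apply: measurableX => //.
  by have [mf _] := bf t; rewrite -[X in measurable X]setTI; exact: mf.
have /choice[C hC] : forall t, exists c : R, forall x, `|f t x| <= c.
  move=> t; have /bounded_measurableP[_ [c hc]] := bf t.
  by exists c => x; exact: hc.
have [s sE] := (finite_seqP _).1 finT.
exists (\big[Num.max/0]_(t <- s) C t) => -[t x] _ /=.
apply: (le_trans (hC t x)); apply: le_bigmax_seq => //.
by have : [set: T] t by []; rewrite sE.
Qed.

End bounded_measurable_theory.

Section losses.
Context (R : realType) (K' M' : nat) dX (X : measurableType dX).
Local Notation D := (decision K').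
Local Notation Y := (outcome M').
Local Notation YD := (potential K' M').

Lemma is_lossP (l : D -> YD -> X -> R) :
  is_loss l <-> forall d y, bounded_measurable setT (l d y).
Proof.
split=> [bl d y|bl].
  rewrite (_ : l d y = (fun p : D * YD * X => l p.1.1 p.1.2 p.2) \o pair (d, y))//.
  by apply: (bounded_measurable_comp measurableT _ _ bl).
apply: (@bounded_measurable_finite_prod _ _ _ (D * YD)%type _ (fun t => l t.1 t.2)) => //.
- by rewrite -setXTT; apply: finite_setX; exact: finite_finset.
- case=> d y; rewrite (_ : [set _] = [set d] `*` [set y]).
    exact: measurableX.
  by apply/seteqP; split=> [_ -> //|[? ?] [/= -> ->]].
Qed.

Lemma is_std_lossP (s : D -> Y -> X -> R) :
  is_std_loss s <-> forall d a, bounded_measurable setT (s d a).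
Proof.
split=> [/is_lossP bs d a|bs].
  (* constant profiles reach every value of the outcome *)
  by have := bs d [ffun=> a]; rewrite /std_loss ffunE.
by apply/is_lossP => d y; exact: bs.
Qed.
End losses.

(** * The conditional law of the potential outcomes *)

Section cond_prob_theory.
Context (R : realType) (K' M' : nat) dX (X : measurableType dX).
Local Notation YD := (potential K' M').
Variable Q : probability (YD * X)%type R.

Lemma joint_at_dominated (y : YD) : joint_at Q y `<< covariate_law Q.
Proof.
apply/null_content_dominatesP => A mA QA0; apply/eqP.
rewrite -measure_le0 -QA0 /covariate_law /distribution /pushforward.
apply: le_measure; rewrite ?inE; first exact: measurableX.
  by rewrite -[X in measurable X]setTI; exact: measurable_snd.
by move=> [? ?] [].
Qed.

(** Domination makes the chosen Radon-Nikodym derivative finite everywhere, so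
    that taking its real part loses no information. *)
Lemma EFin_cond_prob (y : YD) x :
  (cond_prob Q y x)%:E = ('d (joint_at Q y) '/d (covariate_law Q)) x.
Proof.
by rewrite fineK//; apply: Radon_Nikodym_fin_num; exact: joint_at_dominated.
Qed.

Lemma cond_prob_integrable (y : YD) :
  (covariate_law Q).-integrable setT (EFin \o cond_prob Q y).
Proof.
apply: (@eq_integrable _ _ _ _ _ measurableT
  ('d (joint_at Q y) '/d (covariate_law Q))).
  by move=> x _ /=; rewrite EFin_cond_prob.
by apply: Radon_Nikodym_integrable; exact: joint_at_dominated.
Qed.

Lemma integral_cond_prob (y : YD) (A : set X) : measurable A ->
  (\int[covariate_law Q]_(x in A) (cond_prob Q y x)%:E)%E =
  Q ([set y] `*` A).
Proof.
move=> mA; under eq_integral do rewrite EFin_cond_prob.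
by rewrite -Radon_Nikodym_integral//; exact: joint_at_dominated.
Qed.

End cond_prob_theory.

(** * Risk of a policy *)

Section risk_theory.
Context (R : realType) (K' M' : nat) dX (X : measurableType dX).
Local Notation D := (decision K').
Local Notation YD := (potential K' M').

Lemma policy_le1 (pi : policy R K' X) x (d : D) : (pi x [set d] <= 1)%E.
Proof.
by rewrite -(@prob_kernel _ _ _ _ _ pi x); apply: le_measure; rewrite ?inE.
Qed.

Lemma policy_fin_num (pi : policy R K' X) x (d : D) :
  pi x [set d] \is a fin_num.
Proof. by rewrite ge0_fin_numE// (le_lt_trans (policy_le1 _ _ _))// ltry. Qed.

Lemma bounded_measurable_policy (pi : policy R K' X) (d : D) :
  bounded_measurable setT (fun x => fine (pi x [set d])).
Proof.
apply/bounded_measurableP; split.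
  by apply: measurableT_comp => //; exact: measurable_kernel.
exists 1 => x _; rewrite ger0_norm ?fine_ge0// -lee_fin fineK ?policy_le1//.
exact: policy_fin_num.
Qed.

Lemma sum_policy (pi : policy R K' X) x : \sum_(d : D) fine (pi x [set d]) = 1.
Proof.
apply: EFin_inj; rewrite -sumEFin.
rewrite -[RHS](@prob_kernel _ _ _ _ _ pi x).
rewrite (_ : [set: D] = \big[setU/set0]_(d : D) [set d]); last first.
  by rewrite -bigcup_seq; apply/seteqP; split=> // d _;
    exists d; rewrite //= mem_index_enum.
rewrite measure_bigsetU_ord//; last by apply/trivIsetP => i j _ _ /eqP ij;
  apply/seteqP; split=> // d [/= -> /ij].
by apply: eq_bigr => d _; rewrite fineK// policy_fin_num.
Qed.

Definition conditional_risk (Q : probability (YD * X)%type R)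
    (pi : policy R K' X) (l : D -> YD -> X -> R) (x : X) : R :=
  \sum_(d : D) \sum_(y : YD) l d y x * fine (pi x [set d]) * cond_prob Q y x.

Lemma conditional_risk_integrable Q (pi : policy R K' X) l : is_loss l ->
  (covariate_law Q).-integrable setT (EFin \o conditional_risk Q pi l).
Proof.
move=> /is_lossP bl; apply: (@eq_integrable _ _ _ _ _ measurableT
  (fun x => \sum_(d : D) \sum_(y : YD)
     (l d y x * fine (pi x [set d]))%:E * (cond_prob Q y x)%:E)%E).
  move=> x _; rewrite /= -sumEFin; apply: eq_bigr => d _.
  by rewrite -sumEFin; apply: eq_bigr => y _; rewrite -EFinM.
apply: integrable_sum => // d _; apply: integrable_sum => // y _.
have [mlp blp] := bounded_measurableM (bl d y) (bounded_measurable_policy pi d).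
exact: (integrableMr measurableT mlp blp (cond_prob_integrable Q y)).
Qed.

Lemma riskE (P : probability (D * (YD * X))%type R) (pi : policy R K' X) l :
  risk P pi l = fine (\int[covariate_law (potential_law P)]_x
    (conditional_risk (potential_law P) pi l x)%:E)%E.
Proof. by rewrite /risk unlock. Qed.

Lemma risk_gapE (P : probability (D * (YD * X))%type R) (pi : policy R K' X)
    l l' : is_loss l -> is_loss l' ->
  risk P pi l - risk P pi l' =
  fine (\int[covariate_law (potential_law P)]_x
    (conditional_risk (potential_law P) pi
       (fun d y x => l d y x - l' d y x) x)%:E)%E.
Proof.
move=> bl bl'; rewrite !riskE -fineB; last 2 first.
- by apply: integrable_fin_num => //; exact: conditional_risk_integrable.
- by apply: integrable_fin_num => //; exact: conditional_risk_integrable.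
rewrite -integralB_EFin//; [|exact: conditional_risk_integrable..].
congr fine; apply: eq_integral => x _; rewrite -EFinB -sumrB; congr (_%:E).
apply: eq_bigr => d _; rewrite -sumrB; apply: eq_bigr => y _.
by rewrite !mulrBl.
Qed.

(** The policy enters a conditional risk linearly; against a loss that ignores
    the decision it contributes only its total mass, one. *)
Lemma policy_free_gap_of_pointwise (l l' : D -> YD -> X -> R)
    (c : YD -> X -> R) : is_loss l -> is_loss l' ->
  (forall d y x, l d y x - l' d y x = c y x) -> policy_free_gap l l'.
Proof.
move=> bl bl' lc P _ pi pi'; rewrite !risk_gapE//; congr fine.
set Q := potential_law P; apply: eq_integral => x _; congr (_%:E).
suff cE pi0 : conditional_risk Q pi0 (fun d y x => l d y x - l' d y x) x =
    \sum_(y : YD) c y x * cond_prob Q y x by rewrite !cE.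
rewrite /conditional_risk exchange_big; apply: eq_bigr => y _ /=.
under eq_bigr do rewrite lc.
by rewrite -mulr_suml -mulr_sumr sum_policy mulr1.
Qed.

(** Stated for measures that agree with a point mass on measurable sets, since
    the covariate law of a point mass is a push-forward. *)
Lemma integral_point_mass (mu : probability X R) (x0 : X) (f : X -> \bar R) :
  (forall A, measurable A -> mu A = \d_x0 A) -> measurable_fun setT f ->
  (\int[mu]_x f x)%E = f x0.
Proof.
move=> muE mf; rewrite (eq_measure_integral (dirac x0)) => [|A mA _];
  last exact: muE.
by rewrite integral_dirac// diracT mul1e.
Qed.

Section point_mass.
Variables (Q : probability (YD * X)%type R) (y0 : YD) (x0 : X).
Hypothesis QE : forall A, measurable A -> Q A = \d_(y0, x0) A.

Lemma covariate_law_point_mass A : measurable A -> covariate_law Q A = \d_x0 A.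
Proof.
move=> mA; transitivity (Q (snd @^-1` A)); first by [].
rewrite QE ?diracE//.
by rewrite -[X in measurable X]setTI; exact: measurable_snd.
Qed.

(** A conditional probability is determined only almost everywhere, but the atom
    [x0] has full mass: the integral over the whole space reads off its value
    there, even if the singleton of [x0] is not measurable. *)
Lemma cond_prob_point_mass y : cond_prob Q y x0 = (y == y0)%:R.
Proof.
apply: EFin_inj; have := integral_cond_prob Q y measurableT.
rewrite (integral_point_mass covariate_law_point_mass); last first.
  exact/(measurable_int (covariate_law Q))/cond_prob_integrable.
move=> ->; rewrite QE; last exact: measurableX.
rewrite diracE; congr (((nat_of_bool _)%:R)%:E); apply/idP/idP; rewrite inE.
  by move=> [/= -> _].
by move=> /eqP ->.
Qed.

Lemma conditional_risk_point_mass pi l :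
  conditional_risk Q pi l x0 = \sum_(d : D) l d y0 x0 * fine (pi x0 [set d]).
Proof.
apply: eq_bigr => d _; rewrite (bigD1 y0)//= cond_prob_point_mass eqxx mulr1.
rewrite big1 ?addr0// => y /negPf yy0.
by rewrite cond_prob_point_mass yy0 mulr0.
Qed.

End point_mass.

Definition always (d : D) : policy R K' X := kdirac (measurable_cst d).

Lemma alwaysE d x d' : fine (always d x [set d']) = (d == d')%:R.
Proof.
transitivity (fine (\d_d [set d'] : \bar R)); first by [].
by rewrite diracE; case: eqP => [->|dd']; [rewrite mem_set|rewrite memNset].
Qed.

Lemma risk_always_point_mass (P : probability (D * (YD * X))%type R)
    (y0 : YD) (x0 : X) d l :
  (forall A, measurable A -> potential_law P A = \d_(y0, x0) A) -> is_loss l ->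
  risk P (always d) l = l d y0 x0.
Proof.
move=> PE bl; rewrite riskE (integral_point_mass (covariate_law_point_mass PE)).
  rewrite (conditional_risk_point_mass PE) (bigD1 d)// alwaysE eqxx mulr1.
  rewrite big1 => [|d' /negPf d'd]; first by rewrite /= addr0.
  by rewrite alwaysE eq_sym d'd mulr0.
apply: (measurable_int (covariate_law (potential_law P))).
exact: conditional_risk_integrable.
Qed.

End risk_theory.

(** * Randomised trials *)

Lemma mnormalize_gt0 d (T : measurableType d) (R : realType)
    (mu : {measure set T -> \bar R}) (P : probability T R) (A : set T) :
  measurable A -> mu setT \is a fin_num -> (0 < mu A)%E ->
  (0 < mnormalize mu P A)%E.
Proof.
move=> mA muT muA; have muT_gt0 : (0 < mu setT)%E.
  by apply: (lt_le_trans muA); apply: le_measure; rewrite ?inE.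
have muT_lty : (mu setT < +oo)%E by rewrite ltey_eq muT.
rewrite /mnormalize gt_eqF// lt_eqF//= mule_gt0// lte_fin invr_gt0.
by rewrite fine_gt0// muT_gt0.
Qed.

Section randomised_trial.
Context (R : realType) (K' M' : nat) dX (X : measurableType dX).
Local Notation D := (decision K').
Local Notation YD := (potential K' M').

Definition uniform_decision : probability D R :=
  mnormalize (@counting D R) (dirac ord0).

Lemma uniform_decision_gt0 (d : D) : (0 < uniform_decision [set d])%E.
Proof.
apply: mnormalize_gt0 => //=; rewrite /counting asboolT; try exact: finite_finset.
  by [].
by rewrite fset_set1 finmap.cardfs1.
Qed.

Variables (U : probability D R) (Q : probability (YD * X)%type R).
Hypothesis U_gt0 : forall d, (0 < U [set d])%E.

Definition randomised_law : probability (D * (YD * X))%type R := (U \x Q)%E.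

Lemma randomised_lawE (A : set D) (B : set (YD * X)) :
  measurable A -> measurable B -> randomised_law (A `*` B) = (U A * Q B)%E.
Proof. by move=> mA mB; exact: product_measure1E. Qed.

Lemma potential_law_randomised B :
  measurable B -> potential_law randomised_law B = Q B.
Proof.
move=> mB; transitivity (randomised_law ([set: D] `*` B)).
  by rewrite setTX.
by rewrite randomised_lawE// probability_setT mul1e.
Qed.

(** A decision drawn independently of everything else is unconfounded, and has
    overlap as soon as each decision has positive probability; the law of the
    potential outcomes and covariates is thus unconstrained. *)
Lemma ignorable_randomised : ignorable_laws randomised_law.
Proof.
pose e : mechanism R K' M' X :=
  kprobability (measurable_cst (U : pprobability D R)).
pose e0 : R.-pker X ~> D :=
  kprobability (measurable_cst (U : pprobability D R)).
exists e, Q; split.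
  exists e0; split; first exact: aeW.
  by apply: aeW => x d; exact: U_gt0.
move=> k y A mA.
rewrite randomised_lawE//; last exact: measurableX.
have UkE : U [set k] = (fine (U [set k]))%:E by rewrite fineK ?fin_num_measure.
rewrite -integral_cond_prob// UkE -integralZl//; last first.
  by apply: (integrableS measurableT mA) => //; exact: cond_prob_integrable.
by apply: eq_integral => x _; rewrite -UkE.
Qed.

End randomised_trial.

(** * Pointwise form of policy independence *)

Section pointwise.
Context (R : realType) (K' M' : nat) dX (X : measurableType dX).
Local Notation D := (decision K').
Local Notation Y := (outcome M').
Local Notation YD := (potential K' M').

(** Point masses separate the points [(y, x)], and constant policies separate the
    decisions. *)
Lemma policy_free_gapP (l l' : D -> YD -> X -> R) : is_loss l -> is_loss l' ->
  policy_free_gap l l' <->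
  forall d d' y x, l d y x - l' d y x = l d' y x - l' d' y x.
Proof.
move=> bl bl'; split=> [gap d d' y x|ll'].
  pose P := randomised_law (uniform_decision R K') (\d_(y, x) : probability _ R).
  have PE A : measurable A -> potential_law P A = \d_(y, x) A.
    by move=> mA; rewrite potential_law_randomised.
  have iP : ignorable_laws P.
    by apply: ignorable_randomised => k; exact: uniform_decision_gt0.
  by have := gap P iP (always R X d) (always R X d');
    rewrite !(risk_always_point_mass _ PE).
by apply: (policy_free_gap_of_pointwise
  (c := fun y x => l ord0 y x - l' ord0 y x)) => // d y x; exact: ll'.
Qed.

Variables (w0 : YD -> X -> R) (w : D -> D -> Y -> X -> R).
Hypothesis bw0 : bounded_measurable [set: YD * X] (fun p => w0 p.1 p.2).
Hypothesis bw : forall k,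
  bounded_measurable [set: D * Y * X] (fun p => w k p.1.1 p.1.2 p.2).

Definition residual (s : D -> Y -> X -> R) d (y : YD) x : R :=
  \sum_k w k d (y k) x - s d (y d) x.

Definition decision_free_residual s :=
  forall d d' y x, residual s d y x = residual s d' y x.

Lemma bounded_measurable_weight k d a : bounded_measurable setT (w k d a).
Proof.
exact: (@bounded_measurable_comp R _ _ X _ _ _ (pair (d, a)) measurableT _ _ (bw k)).
Qed.

Lemma is_loss_add : is_loss (add_loss w0 w).
Proof.
apply/is_lossP => d y; apply: bounded_measurableD.
  exact: (@bounded_measurable_comp R _ _ X _ _ _ (pair y) measurableT _ _ bw0).
by apply: bounded_measurable_sum => k _; exact: bounded_measurable_weight.
Qed.

Lemma policy_free_std_lossP s : is_std_loss s ->
  policy_free_gap (add_loss w0 w) (std_loss s) <-> decision_free_residual s.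
Proof.
move=> bs; rewrite (policy_free_gapP is_loss_add bs) /add_loss /std_loss.
split=> h d d' y x; first by apply: (addrI (w0 y x)); rewrite !addrA.
by rewrite -!addrA; congr (_ + _); exact: h.
Qed.

Lemma is_std_loss_induced f g :
  (forall k, offdiag_decomp k (w k) (f k) (g k)) ->
  is_std_loss (induced_std_loss w f g).
Proof.
move=> fg; apply/is_std_lossP => d a; apply: bounded_measurableD.
  apply: bounded_measurableB; first exact: bounded_measurable_weight.
  have [_ bg _] := fg d.
  exact: (@bounded_measurable_comp R _ _ X _ _ _ (pair a) measurableT _ _ bg).
apply: bounded_measurable_sum => k kd; have [bf _ _] := fg k.
apply: (@bounded_measurable_comp R _ _ X _ _ _ (pair d) _ _ _ bf) => //.
- exact: measurableX.
- by move=> x; split=> //=; rewrite eq_sym.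
Qed.

(** * Separability and residuals *)

Lemma residual_induced f g :
  (forall k, offdiag_decomp k (w k) (f k) (g k)) ->
  forall d y x,
  residual (induced_std_loss w f g) d y x = \sum_k g k (y k) x.
Proof.
move=> fg d y x; rewrite /residual /induced_std_loss (bigD1 d)//= [RHS](bigD1 d)//=.
rewrite (eq_bigr (fun k => f k d x + g k (y k) x)) => [|k kd]; last first.
  by have [_ _] := fg k; apply; rewrite eq_sym.
rewrite big_split/=; ring.
Qed.

(** Two decisions other than [k] see the outcome [y k] through [w k] only, so
    that in the difference of their residuals the [a]-dependence of
    [w k d a x - w k d0 a x] must cancel; [d0] serves as the reference decision
    that defines the outcome component [g]. *)
Lemma offdiag_separable_of_residual s k (d0 : D) : d0 != k ->
  decision_free_residual s -> offdiag_separable k (w k).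
Proof.
move=> d0k hs.
exists (fun d x => w k d ord0 x - w k d0 ord0 x), (fun a x => w k d0 a x); split.
- apply: (@bounded_measurable_sub R _ _ setT) => //.
  apply: (bounded_measurable_finite_prod
    (f := fun (d : D) x => w k d ord0 x - w k d0 ord0 x)) => [|//|d];
    first exact: finite_finset.
  by apply: bounded_measurableB; exact: bounded_measurable_weight.
- apply: (bounded_measurable_finite_prod (f := fun a : Y => w k d0 a)) => [|//|a];
    first exact: finite_finset.
  exact: bounded_measurable_weight.
move=> d a x dk.
(* a profile that is zero except at [k] *)
pose y b : YD := [ffun j => if j == k then b else ord0].
have yE b e : e != k -> (y b) e = ord0 by move=> /negPf ek; rewrite ffunE ek.
have sumE b e : \sum_j w j e (y b j) x =
    w k e b x + \sum_(j | j != k) w j e ord0 x.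
  rewrite (bigD1 k)//= ffunE eqxx; congr (_ + _).
  by apply: eq_bigr => j jk; rewrite yE.
have := hs d d0 (y a) x; have := hs d d0 (y ord0) x.
rewrite /residual !sumE !yE//; lra.
Qed.

Lemma exists_other_decision (d : D) : (1 < K'.+1)%N -> exists e : D, e != d.
Proof.
case: K' d => // n d _.
by exists (lift d ord0); rewrite eq_sym neq_lift.
Qed.

(** For [d != d'] a profile can take the values [a] at [d] and [a'] at [d'], and
    the two residuals then give the equality; for [d = d'] one passes through a
    second decision. *)
Lemma std_loss_difference_const (s t : D -> Y -> X -> R) : (1 < K'.+1)%N ->
  decision_free_residual s -> decision_free_residual t ->
  forall d d' a a' x, s d a x - t d a x = s d' a' x - t d' a' x.
Proof.
move=> K1 hs ht.
have eq_neq d d' a a' x : d != d' -> s d a x - t d a x = s d' a' x - t d' a' x.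
  move=> dd'; pose y : YD := [ffun j => if j == d then a else a'].
  have := hs d d' y x; have := ht d d' y x.
  rewrite /residual /y !ffunE eqxx eq_sym (negPf dd'); lra.
move=> d d' a a' x; have [<-|] := eqVneq d d'; last exact: eq_neq.
have [e ed] := exists_other_decision d K1.
by rewrite (@eq_neq d e a a) 1?eq_sym// (@eq_neq e d a a').
Qed.

End pointwise.

Theorem proposition2 (R : realType) (dX : measure_display)
    (X : measurableType dX) (K' M' : nat)
    (hK : (3 <= K'.+1)%N) (hM : (2 <= M'.+1)%N)
    (w0 : potential K' M' -> X -> R)
    (w : decision K' -> decision K' -> outcome M' -> X -> R)
    (hw0 : bounded_measurable [set: potential K' M' * X]
             (fun p => w0 p.1 p.2))
    (hw : forall k : decision K',
       bounded_measurable [set: decision K' * outcome M' * X]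
         (fun p => w k p.1.1 p.1.2 p.2)) :
  ((~ exists s : decision K' -> outcome M' -> X -> R,
        is_std_loss s /\ policy_free_gap (add_loss w0 w) (std_loss s)) <->
   (exists k : decision K', ~ offdiag_separable k (w k)))
  /\
  (forall (f : decision K' -> decision K' -> X -> R)
      (g : decision K' -> outcome M' -> X -> R),
    (forall k : decision K', offdiag_decomp k (w k) (f k) (g k)) ->
    [/\ is_std_loss (induced_std_loss w f g),
        policy_free_gap (add_loss w0 w) (std_loss (induced_std_loss w f g)) &
        forall s : decision K' -> outcome M' -> X -> R, is_std_loss s ->
          (policy_free_gap (add_loss w0 w) (std_loss s) <->
           exists h : X -> R, bounded_measurable [set: X] h /\
             forall (d : decision K') (y : outcome M') (x : X),
               s d y x = induced_std_loss w f g d y x + h x)]).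
Proof.
have K1 : (1 < K'.+1)%N by exact: ltnW.
have inducedP f g : (forall k, offdiag_decomp k (w k) (f k) (g k)) ->
    is_std_loss (induced_std_loss w f g) /\
    policy_free_gap (add_loss w0 w) (std_loss (induced_std_loss w f g)).
  move=> fg; have bi := is_std_loss_induced hw fg; split=> //.
  apply/(policy_free_std_lossP hw0 hw bi) => d d' y x.
  by rewrite !(residual_induced fg).
split.
  split=> [|[k nsep] [s [bs gap]]].
    apply: contra_notP => /forallNP sep.
    have /choice[f] : forall k, exists fk, exists gk,
        offdiag_decomp k (w k) fk gk by move=> k; exact: contrapT (sep k).
    move=> /choice[g fg].
    by exists (induced_std_loss w f g); exact: inducedP.
  apply: nsep; have [d0 d0k] := exists_other_decision k K1.
  apply: (offdiag_separable_of_residual hw d0k).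
  exact: (policy_free_std_lossP hw0 hw bs).1 gap.
move=> f g fg; have [bi gapi] := inducedP _ _ fg; split=> // s bs.
rewrite (policy_free_std_lossP hw0 hw bs); split=> [hs|[h [_ hE]] d d' y x].
  have hi := (policy_free_std_lossP hw0 hw bi).1 gapi.
  exists (fun x => s ord0 ord0 x - induced_std_loss w f g ord0 ord0 x); split.
    apply: bounded_measurableB; first exact: (is_std_lossP s).1 bs _ _.
    exact: (is_std_lossP _).1 bi _ _.
  move=> d a x; apply/eqP; rewrite addrC -subr_eq; apply/eqP.
  exact: std_loss_difference_const.
have sE e : residual w s e y x = \sum_k g k (y k) x - h x.
  by rewrite -(residual_induced fg e) /residual hE opprD addrA.
by rewrite !sE.
Qed.
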